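(* Assume Kriesell's conjecture for finite graphs, i.e. assume that for every positive integer $m$, every finite connected graph $H$ and every $2m$-edge-connected subset $R\subseteq V(H)$, the graph $H$ contains $m$ pairwise edge-disjoint $R$-Steiner trees. Let $F$ be a non-principal ultrafilter on $\mathbb{N}$, let $k$ be a positive integer, let $G$ be a rayless connected graph and let $S\subseteq V(G)$ be a $2k$-edge-connected subset. Then $G$ contains $k$ pairwise edge-disjoint subgraphs, each of which contains $S$ in its vertex set and is the $F$-limit of a sequence of trees of $G$.
   Context: All graphs are simple (no loops, no multiple edges) and may be of any cardinality. A graph is rayless if it contains no one-way infinite path. A subset $S\subseteq V(G)$ is $m$-edge-connected (in $G$) if for every pair of vertices $u,v\in S$ there are $m$ pairwise edge-disjoint $u$–$v$ paths in $G$ (the paths may leave $S$). A tree of $G$ is a subgraph of $G$ that is a tree. An $S$-Steiner tree of $G$ is a tree $T\subseteq G$ with $S\subseteq V(T)$. For a non-principal ultrafilter $F$ on $\mathbb{N}$ and a sequence $\langle H_n\rangle_{n\in\mathbb{N}}$ of subgraphs of $G$, the $F$-limit of $\langle H_n\rangle_n$ is the subgraph $H$ of $G$ with $V(H)=\{v\in V(G):\{n: v\in V(H_n)\}\in F\}$ and $E(H)=\{e\in E(G):\{n: e\in E(H_n)\}\in F\}$. Subgraphs are edge-disjoint if they have no common edge. *)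

(* Defs.v *)
From HB Require Import structures.
From mathcomp Require Import all_boot.
From mathcomp Require Import boolp classical_sets cardinality filter.

Set Implicit Arguments.
Unset Strict Implicit.
Unset Printing Implicit Defensive.

Local Open Scope classical_set_scope.

(* A simple graph whose vertices form an arbitrary subset of [T], so that a
   graph and its subgraphs have the same type.  Neither the choiceType structure
   on [T] nor the boolean adjacency relation restricts the graphs: classically
   every type is a choiceType and every relation is boolean. *)
Record graph (T : choiceType) := Graph {
  vset : set T;
  adj : rel T;
  adj_sym : symmetric adj;
  adj_irr : irreflexive adj;
  adj_vset : forall x y, adj x y -> vset x
}.

Section Graphs.
Variable T : choiceType.
Implicit Types (G H : graph T) (S : set T) (u v x y : T) (p q : seq T).

Definition subgraph H G : Prop :=
  vset H `<=` vset G /\ (forall x y, adj H x y -> adj G x y).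

Definition edge_disjoint H1 H2 : Prop :=
  forall x y, ~ (adj H1 x y /\ adj H2 x y).

(* [u :: p] lists the vertices of the path, which are distinct. *)
Definition is_path G u v p : Prop :=
  [/\ vset G u, path (adj G) u p, uniq (u :: p) & last u p = v].

Definition path_edge u p x y : Prop :=
  (x, y) \in zip (u :: p) p \/ (y, x) \in zip (u :: p) p.

(* Following the usual convention, a connected graph is nonempty. *)
Definition connected_graph G : Prop :=
  vset G !=set0 /\
  (forall u v, vset G u -> vset G v -> exists p, is_path G u v p).

Definition acyclic_graph G : Prop :=
  ~ exists c : seq T, 2 < size c /\ ucycle (adj G) c.

Definition tree_graph G : Prop := connected_graph G /\ acyclic_graph G.

Definition tree_of G H : Prop := subgraph H G /\ tree_graph H.

Definition rayless G : Prop :=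
  ~ exists r : nat -> T, injective r /\ (forall n, adj G (r n) (r n.+1)).

Definition edge_connected_in m G S : Prop :=
  forall u v, S u -> S v -> u <> v ->
  exists P : 'I_m -> seq T,
    (forall i, is_path G u v (P i)) /\
    (forall i j, i <> j ->
       forall x y, ~ (path_edge u (P i) x y /\ path_edge u (P j) x y)).

Definition steiner_tree G S H : Prop := tree_of G H /\ S `<=` vset H.

Definition is_flimit (F : set_system nat) G (Hs : nat -> graph T) H : Prop :=
  [/\ subgraph H G,
      (forall v, vset H v <-> vset G v /\ F [set n | vset (Hs n) v]) &
      (forall x y, adj H x y <-> adj G x y /\ F [set n | adj (Hs n) x y])].

End Graphs.

Definition kriesell_conjecture : Prop :=
  forall (m : nat) (T : choiceType) (H : graph T) (R : set T),
    0 < m ->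
    finite_set (vset H) -> connected_graph H ->
    R `<=` vset H -> edge_connected_in (2 * m) H R ->
    exists Ts : 'I_m -> graph T,
      (forall i, steiner_tree H R (Ts i)) /\
      (forall i j, i <> j -> edge_disjoint (Ts i) (Ts j)).

(* Main.v *)
Require Import Defs.
From HB Require Import structures.
From mathcomp Require Import all_boot.
From mathcomp Require Import boolp classical_sets cardinality filter.
From mathcomp Require Import zify.

(** When [S] is countable, the theorem follows by exhausting [S] with finite sets:
    Kriesell's conjecture, applied to a finite subgraph that contains the required
    paths, yields [k] edge-disjoint trees containing the [n]-th finite set, and each
    vertex of [S] lies in the [n]-th trees for almost all [n], hence in their limits.
    The work lies in treating an uncountable [S] with countably many steps, and this
    is where raylessness is used.

    Fix a root [s] in [S] and enlarge [S] to the class [K] of all vertices that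
    cannot be separated from [s] by fewer than [2k] edges ([cut_class]).  By Menger's theorem
    ([menger]) any two vertices of [K] are joined by [2k] edge-disjoint paths.
    Moreover a vertex that no finite vertex set separates from [K] belongs to [K]
    ([cut_class_unblocked]).

    A rayless connected graph can be decomposed recursively: deleting vertices one
    by one, each adjacent to the previous one and inside the current component, must
    stop.  Hence ([rayless_decomposable]) there is a well-founded recursion in which
    one removes a suitable countable set [M] from a connected vertex set [C], and
    each remaining component has finitely many neighbours and is treated in turn.

    For such a [C] one constructs, for each [n], a system of [k] edge-disjoint forests
    in [C], rooted outside [C] or at [s], so that each vertex of [K] in [C] is covered
    for all large [n] ([decomposable_limit_forests]).  Inside [M] the finite case is
    exhausted as above; a tree rooted at [s] becomes a rooted forest in [C] by keeping
    the edges from the vertices of [C] to their parents ([finite_forests]).  Each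
    component of [C] minus [M] has its own forests by induction, rooted at its finitely
    many neighbours.  If [M] is sufficiently closed, these neighbours are in [K]
    whenever the component meets [K]; so they are covered at all late stages, and the
    forests can be grafted onto those of [M] ([glue_forest_systems]).

    For [C] the whole vertex set, the forests are trees rooted at [s].  Every vertex of
    [S] is in almost all of them, and the limits are edge-disjoint because two members
    of a filter intersect. *)

Set Implicit Arguments.
Unset Strict Implicit.
Unset Printing Implicit Defensive.

Local Open Scope classical_set_scope.

(** * Edge-disjoint paths and cuts *)

(** The dual form of local edge-connectivity.  Listing the cut edges as pairs
    that point out of [X] fixes one orientation of each edge, so that distinct
    pairs are distinct edges. *)
Definition cut_connected {T : choiceType} (G : graph T) m (u v : T) : Prop :=
  forall X : set T, X u -> ~ X v ->
  exists l : seq (T * T), [/\ uniq l, m <= size l &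
    forall e, e \in l -> [/\ adj G e.1 e.2, X e.1 & ~ X e.2]].

Definition arcs {T : Type} (u : T) p : seq (T * T) := zip (u :: p) p.

Definition valid_arcs {T : choiceType} (G : graph T) (D : seq (T * T)) : Prop :=
  uniq D /\ forall e, e \in D -> adj G e.1 e.2 /\ (e.2, e.1) \notin D.

(** Conservation of flow, with sources [A] and sinks [B] counted with
    multiplicity.  Testing against every predicate [a] gives at once the law at
    a single vertex and the net flow out of an arbitrary vertex set. *)
Definition balanced {T : choiceType} (D : seq (T * T)) (A B : seq T) : Prop :=
  forall a : pred T,
    count (fun e => a e.1) D + count a B = count (fun e => a e.2) D + count a A.

Section Menger.
Variables (T : choiceType) (G : graph T).
Implicit Types (u v w x y : T) (p : seq T) (D : seq (T * T)) (X : set T).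

Lemma path_arcs (e : rel T) u p a : path e u p -> a \in arcs u p -> e a.1 a.2.
Proof.
elim: p u => [|y p IH] u //= /andP[euy pth].
by rewrite /arcs /= inE => /orP[/eqP->//|]; apply: IH.
Qed.

Lemma arcs_vertex u p a : a \in arcs u p -> (a.1 \in u :: p) /\ (a.2 \in p).
Proof.
elim: p u => [|y p IH] u //=; rewrite /arcs /= inE => /orP[/eqP->/=|/IH[h1 h2]].
  by rewrite !mem_head.
by rewrite inE h1 orbT inE h2 orbT.
Qed.

Lemma arcs_crossing X u p : X u -> ~ X (last u p) ->
  exists2 a, a \in arcs u p & X a.1 /\ ~ X a.2.
Proof.
elim: p u => [|y p IH] u //= Xu Xl.
have [Xy|nXy] := pselect (X y); last by exists (u, y); rewrite ?mem_head.
by have [a ain aP] := IH y Xy Xl; exists a => //; rewrite /arcs /= inE ain orbT.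
Qed.

Lemma arcs_uniq u p : uniq (u :: p) -> uniq (arcs u p).
Proof.
elim: p u => [|y p IH] u //= /andP[unin uyp].
rewrite IH ?andbT//; apply/negP => /arcs_vertex[/= h _].
by rewrite h in unin.
Qed.

Lemma arcs_balanced u p (a : pred T) :
  count (fun e => a e.1) (arcs u p) + a (last u p) =
  count (fun e => a e.2) (arcs u p) + a u.
Proof.
elim: p u => [|y p IH] u //=; have := IH y; rewrite /arcs /=; lia.
Qed.

Lemma cut_connected_of_paths m u v (P : 'I_m -> seq T) :
  (forall i, is_path G u v (P i)) ->
  (forall i j, i <> j -> forall x y,
     ~ (path_edge u (P i) x y /\ path_edge u (P j) x y)) ->
  cut_connected G m u v.
Proof.
move=> Ppath Pdisj X Xu Xv.
have cr i : exists a, a \in arcs u (P i) /\ (X a.1 /\ ~ X a.2).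
  have [_ _ _ lst] := Ppath i.
  by have [|a ? ?] := @arcs_crossing X u (P i) Xu; [rewrite lst | exists a].
have [f fP] := choice cr.
exists (map f (enum 'I_m)); split.
- rewrite map_inj_uniq ?enum_uniq// => i j fij.
  apply: contrapT => nij; apply: (Pdisj i j nij (f i).1 (f i).2).
  rewrite /path_edge -surjective_pairing; split; left; first by case: (fP i).
  by rewrite fij; case: (fP j).
- by rewrite size_map size_enum_ord.
- move=> e /mapP[i _ ->]; have [ain [X1 X2]] := fP i; split => //.
  by have [_ pth _ _] := Ppath i; apply: path_arcs pth ain.
Qed.

(** The arcs along which one more unit can be pushed: either a unit running the
    other way is cancelled, or the edge carries nothing yet. *)
Definition residual D x y := ((y, x) \in D) || adj G x y && ((x, y) \notin D).

(** A unit stuck at [w] can be carried along a residual path.  Since the path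
    does not repeat vertices, changing the flow on its first edge leaves the
    residual status of its later edges alone. *)
Lemma push_flow D A B w p : valid_arcs G D -> balanced D A (w :: B) ->
  path (residual D) w p -> uniq (w :: p) ->
  exists2 D', valid_arcs G D' & balanced D' A (last w p :: B).
Proof.
elim: p w D => [|y p IH] w D vD bD; first by exists D.
case: vD => uD aD.
(* Only the edge between [w] and [y] changes, and the rest of the path avoids [w]. *)
have keep D1 : path (residual D) y p -> w \notin y :: p ->
   (forall a b, a != w -> b != w -> ((a, b) \in D1) = ((a, b) \in D)) ->
   path (residual D1) y p.
  move=> pth wn eqD; rewrite -(@eq_in_path _ (predC1 w) (residual D)) //.
    by move=> a b aw bw; rewrite /residual !eqD.
  by apply/allP => z zp; apply: contraNneq wn => <-.
rewrite [path _ _ _]/= [uniq _]/= => /andP[ryw pth] /andP[wn up].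
have [ywD|ywD] := boolP ((y, w) \in D).
  apply: (IH y (rem (y, w) D)) => //.
  - split; first exact: rem_uniq.
    move=> e; rewrite !mem_rem_uniq// !inE => /andP[_ eD].
    have [-> ne] := aD _ eD; split=> //; by rewrite negb_and ne orbT.
  - move=> a; have := bD a; have := permP (perm_to_rem ywD).
    move=> h; rewrite !h /=; lia.
  - apply: keep => // a b aw bw; rewrite mem_rem_uniq// inE.
    by case: eqP => // -[_ bw']; rewrite bw' eqxx in bw.
move: ryw; rewrite /residual (negPf ywD) /= => /andP[awy wyD].
apply: (IH y ((w, y) :: D)) => //.
- split; first by rewrite /= wyD.
  move=> e; rewrite !inE => /orP[/eqP->/=|eD].
    rewrite negb_or ywD awy andbT; split=> //.
    by apply/eqP => -[yw _]; rewrite yw adj_irr in awy.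
  have [-> ne] := aD _ eD; split=> //; rewrite negb_or ne andbT.
  apply/eqP => -[e2 e1]; move: ywD; rewrite -e1 -e2.
  by rewrite -surjective_pairing eD.
- by move=> a; have := bD a; rewrite /=; lia.
- apply: keep => // a b aw bw; rewrite inE.
  by case: eqP => // -[aw' _]; rewrite aw' eqxx in aw.
Qed.

(** Ford and Fulkerson's argument, by induction on the value [r].  Let [X] be the
    set of vertices reachable by residual paths.  If [X] contains [v], augment.
    Otherwise all edges leaving [X] carry flow and none carries flow into [X], so
    their number is the value [r], against the assumption that every cut has at
    least [m > r] edges.  Only the flow has to be finite, not the graph. *)
Lemma cut_connected_flow m u v : cut_connected G m u v ->
  forall r, r <= m ->
  exists2 D, valid_arcs G D & balanced D (nseq r u) (nseq r v).
Proof.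
move=> cc; elim=> [|r IH] rm; first by exists [::].
have [D vD bD] := IH (ltnW rm).
pose X := [set y | exists2 p, path (residual D) u p & last u p = y].
have Xu : X u by exists [::].
have [[p0 pth0 lst0]|nXv] := pselect (X v).
  move: lst0; case: (shortenP pth0) => p pth up _ lst.
  have [|D' vD' bD'] := @push_flow D (nseq r.+1 u) (nseq r v) u p vD _ pth up.
    by move=> a; have := bD a; rewrite /=; lia.
  by exists D' => //; rewrite lst in bD'.
have [l [ul ml lP]] := cc X Xu nXv.
have closed x y : X x -> residual D x y -> X y.
  by move=> [p pth <-] rxy; exists (rcons p y); rewrite ?last_rcons ?rcons_path ?pth.
pose a : pred T := fun x => `[< X x >].
have := bD a; rewrite !count_nseq.
have -> : a u = true by apply/asboolP.
have -> : a v = false by apply/asboolP.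
have cut : size l <= count (fun e => a e.1 && ~~ a e.2) D.
  rewrite -size_filter; apply: uniq_leq_size => // e el.
  have [ae X1 X2] := lP e el; rewrite mem_filter.
  apply/andP; split; first by apply/andP; split; [apply/asboolP | apply/asboolPn].
  apply: contra_notT X2 => eD; apply: closed X1 _.
  by rewrite /residual ae -surjective_pairing eD orbT.
have h1 : count (fun e => a e.1) D = count (fun e => a e.1 && ~~ a e.2) D +
          count (fun e => a e.1 && a e.2) D.
  by elim: (D) => //= e D' ->; case: (a e.1); case: (a e.2) => /=; lia.
have h2 : count (fun e => a e.2) D = count (fun e => a e.1 && a e.2) D.
  apply: eq_in_count => -[x y] eD /=; case: (boolP (a y)) => [/asboolP Xy|_].
    rewrite andbT; apply/esym/asboolP; apply: closed Xy _.
    by rewrite /residual eD.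
  by rewrite andbF.
lia.
Qed.

(** A flow of positive value contains a path from source to sink, for otherwise
    the vertices reachable from the source would lose more flow than they
    receive; removing the arcs of this path lowers the value by one. *)
Lemma flow_paths r u v D : u != v -> valid_arcs G D ->
  balanced D (nseq r u) (nseq r v) ->
  exists P : nat -> seq T,
    (forall i, i < r -> [/\ path (fun x y => (x, y) \in D) u (P i),
        uniq (u :: P i) & last u (P i) = v]) /\
    (forall i j, i < r -> j < r -> i != j -> forall e,
        e \in arcs u (P i) -> e \notin arcs u (P j)).
Proof.
move=> uv; elim: r D => [|r IH] D [uD aD] bD; first by exists (fun=> [::]).
pose step := fun x y => (x, y) \in D.
pose X := [set y | exists2 p, path step u p & last u p = y].
have [[p0 pth0 lst0]|nXv] := pselect (X v); last first.
  pose a : pred T := fun x => `[< X x >].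
  have := bD a; rewrite !count_nseq.
  have -> : a u = true by apply/asboolP; exists [::].
  have -> : a v = false by apply/asboolP.
  suff : count (fun e => a e.1) D <= count (fun e => a e.2) D by lia.
  rewrite -!size_filter; apply: uniq_leq_size; first exact: filter_uniq.
  move=> -[x y]; rewrite !mem_filter /= => /andP[/asboolP[p pth lp] eD].
  rewrite eD andbT; apply/asboolP; exists (rcons p y); last by rewrite last_rcons.
  by rewrite rcons_path pth lp.
move: lst0; case: (shortenP pth0) => p pth up _ lst.
pose D' := [seq e <- D | e \notin arcs u p].
have D'D e : e \in D' -> e \in D by rewrite mem_filter => /andP[].
have arcsD e : e \in arcs u p -> e \in D.
  by move=> /(path_arcs pth); rewrite /step -surjective_pairing.
have permD : perm_eq D (arcs u p ++ D').
  rewrite perm_sym.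
  apply: perm_trans (permEl (perm_filterC (mem (arcs u p)) D)).
  rewrite perm_cat2r perm_sym.
  apply: uniq_perm; rewrite ?filter_uniq ?arcs_uniq// => e.
  by rewrite mem_filter /=; case: (boolP (e \in arcs u p)) => //= /arcsD.
have [||P [P1 P2]] := IH D'.
- split; first exact: filter_uniq.
  move=> e /D'D eD; have [-> ne] := aD e eD; split=> //.
  by apply: contra ne => /D'D.
- move=> a; have := bD a; rewrite !(permP permD) !count_cat.
  have := arcs_balanced u p a; rewrite lst /=; lia.
have inD' i e : i < r -> e \in arcs u (P i) -> e \notin arcs u p.
  move=> ir eP; have [pthi _ _] := P1 i ir.
  by have := path_arcs pthi eP; rewrite /= -surjective_pairing mem_filter => /andP[].
exists (fun i => if i == r then p else P i); split=> [i|i j].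
  rewrite ltnS leq_eqVlt; case: eqVneq => [_ _|_ /= ir]; first by split.
  have [h1 h2 h3] := P1 i ir; split=> //.
  by apply: sub_path h1 => x y; apply: D'D.
rewrite 2!ltnS (leq_eqVlt i) (leq_eqVlt j).
case: eqVneq => [->|_] /=; case: eqVneq => [->|_] //= ir jr ij e.
- by apply: contraL; apply: inD'.
- exact: inD'.
- exact: P2.
Qed.

(** The edge version of Menger's theorem for an arbitrary graph and a finite
    number of paths. *)
Lemma menger m u v : vset G u -> u <> v -> cut_connected G m u v ->
  exists P : 'I_m -> seq T,
    (forall i, is_path G u v (P i)) /\
    (forall i j, i <> j -> forall x y,
       ~ (path_edge u (P i) x y /\ path_edge u (P j) x y)).
Proof.
move=> Gu /eqP uv cc.
have [D vD bD] := cut_connected_flow cc (leqnn m).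
have [P [P1 P2]] := flow_paths uv vD bD.
case: vD => uD aD.
exists (fun i => P i); split=> [i|i j ij x y].
  have [h1 h2 h3] := P1 i (ltn_ord i); split=> //.
  by apply: sub_path h1 => x y /aD[].
have nij : (i : nat) != j by apply/eqP => /val_inj.
have arcD (i' : 'I_m) z t : (z, t) \in arcs u (P i') -> (z, t) \in D.
  by have [h _ _] := P1 i' (ltn_ord i'); move/(path_arcs h).
rewrite /path_edge -!/(arcs _ _) => -[[h|h] [h'|h']].
- by have := P2 _ _ (ltn_ord i) (ltn_ord j) nij _ h; rewrite h'.
- by have [_ /=] := aD _ (arcD _ _ _ h); rewrite (arcD _ _ _ h').
- by have [_ /=] := aD _ (arcD _ _ _ h'); rewrite (arcD _ _ _ h).
- by have := P2 _ _ (ltn_ord i) (ltn_ord j) nij _ h; rewrite h'.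
Qed.

End Menger.

(** * The class of a vertex under edge-connectivity *)

(** The [m]-edge-connectivity class of [s], described by cuts so that
    transitivity is immediate. *)
Definition cut_class {T : choiceType} (G : graph T) m (s : T) : set T :=
  [set v | vset G v /\ (v = s \/ cut_connected G m v s)].

Section CutClass.
Variables (T : choiceType) (G : graph T) (m : nat) (s : T).
Local Notation K := (cut_class G m s).

(** A set separating [x] from [y] separates one of them from [s]; if it is [y],
    the complement of the set is the one to look at. *)
Lemma cut_class_connected x y : K x -> K y -> x <> y -> cut_connected G m x y.
Proof.
move=> [_ Kx] [_ Ky] xy X Xx nXy; have [Xs|nXs] := pselect (X s).
  case: Ky => [ys|/(_ (~` X) nXy)]; first by rewrite ys in nXy.
  move=> /(_ (fun h => h Xs)) [l [ul ml lP]].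
  exists (map (fun e => (e.2, e.1)) l); split.
  - by rewrite map_inj_uniq// => -[a b] [c d] [-> ->].
  - by rewrite size_map.
  move=> _ /mapP[[a b] /lP[/= ab Xa Xb] ->] /=; split=> //; last exact: contrapT.
  by rewrite adj_sym.
by case: Kx => [xs|/(_ X Xx nXs)//]; rewrite xs in Xx.
Qed.

(** A vertex that no finite set separates from the class belongs to it.  A small
    cut [Y] around [u] that misses [s] has the whole class on its other side.
    Each path from [u] to the class then crosses the cut, and a path avoiding the
    far ends of the cut edges found so far yields a new one. *)
Lemma cut_class_unblocked u : vset G u ->
  (forall X : seq T, exists p, [/\ path (adj G) u p, K (last u p) &
     forall x, x \in p -> x \notin X]) -> K u.
Proof.
move=> Gu fan; split=> //; right=> Y Yu nYs.
have [[t [[_ [ts|tK]] Yt]]|nK] := pselect (exists t, K t /\ Y t).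
- by rewrite ts in Yt.
- exact: tK.
have size_cut j : exists l : seq (T * T), [/\ uniq l, size l = j &
    forall e, e \in l -> [/\ adj G e.1 e.2, Y e.1 & ~ Y e.2]].
  elim: j => [|j [l [ul lj lP]]]; first by exists [::].
  have [p [pth Kl avoid]] := fan (map snd l).
  have [|e ep [Y1 Y2]] := @arcs_crossing _ Y u p Yu.
    by move=> Yl; apply: nK; exists (last u p).
  have [_ /avoid el] := arcs_vertex ep.
  exists (e :: l); split=> /=; last 1 first.
  - move=> e'; rewrite inE => /orP[/eqP->|/lP//]; split=> //.
    exact: path_arcs pth ep.
  - rewrite ul andbT; apply: contra el; exact: map_f.
  - by rewrite lj.
by have [l [? lm ?]] := size_cut m; exists l; rewrite lm.
Qed.

End CutClass.

(** * Components and the decomposition of rayless graphs *)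

Definition joined {T : eqType} (e : rel T) (x y : T) : Prop :=
  exists2 p, path e x p & last x p = y.

Section Joined.
Variables (T : eqType) (e : rel T).

Lemma joined_refl x : joined e x x. Proof. by exists [::]. Qed.

Lemma joined_edge x y : e x y -> joined e x y.
Proof. by exists [:: y]; rewrite //= andbT. Qed.

Lemma joined_trans y x z : joined e x y -> joined e y z -> joined e x z.
Proof.
move=> [p pp <-] [q pq <-]; exists (p ++ q); last by rewrite last_cat.
by rewrite cat_path pp.
Qed.

Lemma path_joined x p y : path e x p -> y \in x :: p -> joined e x y.
Proof.
move=> pth; rewrite inE => /predU1P[->|/splitPr yp]; first exact: joined_refl.
case: yp pth => p1 p2; rewrite -cat_rcons cat_path => /andP[pth _].
by exists (rcons p1 y); rewrite ?last_rcons.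
Qed.

Lemma joined_sym x y : symmetric e -> joined e x y -> joined e y x.
Proof.
move=> se [p]; elim: p x => [|z p IH] x /=.
  by move=> _ ->; apply: joined_refl.
move=> /andP[xz pth] lst; apply: (@joined_trans z); first exact: IH pth lst.
by apply: joined_edge; rewrite se.
Qed.

End Joined.

Lemma joined_is_path {T : choiceType} (G : graph T) u v :
  vset G u -> joined (adj G) u v -> exists p, is_path G u v p.
Proof. by move=> Gu [p pth]; case: (shortenP pth) => q ? ? _ ?; exists q. Qed.

Section Components.
Variables (T : choiceType) (G : graph T).
Implicit Types (A B C D M : set T) (u v w x y : T).

Definition adj_in A : rel T :=
  fun x y => [&& adj G x y, `[< A x >] & `[< A y >]].

Lemma adj_inP A x y : adj_in A x y <-> [/\ adj G x y, A x & A y].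
Proof.
split=> [/and3P[? /asboolP ? /asboolP ?] //|[? ? ?]].
by apply/and3P; split=> //; apply/asboolP.
Qed.

Lemma adj_in_sym A : symmetric (adj_in A).
Proof. by move=> x y; rewrite /adj_in adj_sym; congr (_ && _); apply: andbC. Qed.

Definition component A v : set T := [set w | joined (adj_in A) v w].

(** Only vertices outside [D] count, so this is the neighbourhood of [D] and not
    the union of the neighbourhoods of its vertices. *)
Definition neighbours D : set T := [set u | ~ D u /\ exists2 v, D v & adj G v u].

Definition finite_boundary D := exists B : seq T, forall u, neighbours D u -> u \in B.

Lemma component_self A v : component A v v. Proof. exact: joined_refl. Qed.

Lemma component_sub A v : A v -> component A v `<=` A.
Proof.
move=> Av w [p]; elim: p v Av => [|y p IH] v Av /=; first by move=> _ <-.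
by move=> /andP[/adj_inP[_ _ Ay] pth]; apply: (IH y).
Qed.

Lemma component_eq A v w : component A v w -> component A w = component A v.
Proof.
move=> vw; apply/seteqP; split=> x; first exact: joined_trans.
by apply: joined_trans; apply: joined_sym vw; apply: adj_in_sym.
Qed.

Lemma path_adj_in A B x p : path (adj_in A) x p ->
  (forall y, y \in x :: p -> B y) -> path (adj_in B) x p.
Proof.
move=> pth sub.
apply: (@sub_in_path _ (fun y => `[< B y >]) (adj_in A)) pth => [y z By Bz|].
  by move=> /adj_inP[yz _ _]; apply/and3P.
by apply/allP => y /sub By; apply/asboolP.
Qed.

Lemma component_mono A B v : A `<=` B -> component A v `<=` component B v.
Proof.
move=> AB w [p pth <-]; exists p => //; apply: sub_path pth => x y.
by move=> /adj_inP[? /AB ? /AB ?]; apply/adj_inP.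
Qed.

(** A component does not change when the ambient set shrinks around it; this
    identifies components taken inside different vertex sets. *)
Lemma component_restrict A B v :
  B `<=` A -> component A v `<=` B -> component B v = component A v.
Proof.
move=> BA AB; apply/seteqP; split; first exact: component_mono.
move=> w [p pth <-]; exists p => //; apply: path_adj_in (pth) _ => y yp.
by apply: AB; apply: path_joined pth yp.
Qed.

Lemma neighbours_component A v u :
  A v -> neighbours (component A v) u -> ~ A u.
Proof.
move=> Av [nDu [w Dw wu]] Au; apply: nDu; apply: joined_trans (Dw) _.
by apply: joined_edge; apply/adj_inP; split=> //; apply: component_sub Dw.
Qed.

Lemma finite_boundary_delete C u v : finite_boundary C -> (C `\ u) v ->
  finite_boundary (component (C `\ u) v).
Proof.
move=> [B BP] Cv; exists (u :: B) => x Nx; rewrite inE.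
have [-> //|/eqP xu] := eqVneq x u.
apply/orP; right; apply: BP; have nCx := neighbours_component Cv Nx.
case: Nx => _ [y Dy yx]; split; first by move=> Cx; apply: nCx.
by exists y => //; have [] := component_sub Cv Dy.
Qed.

(** The inductive structure of rayless graphs, in a form suited to closure
    arguments.  The function [h] tells which finite set each vertex requires:
    when a nonempty part of [C] that satisfies all these requirements is removed,
    every remaining component has a finite neighbourhood and is again
    decomposable.  Countable parts of this kind contain any given vertex, and
    further finitary closure conditions can be imposed on them. *)
Inductive decomposable : set T -> Prop :=
  Decomposable C (h : T -> seq T) of
    (forall M v, M `<=` C -> M !=set0 ->
       (forall x y, M x -> y \in h x -> C y -> M y) -> (C `\` M) v ->
       finite_boundary (component (C `\` M) v)) &
    (forall M v, M `<=` C -> M !=set0 ->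
       (forall x y, M x -> y \in h x -> C y -> M y) -> (C `\` M) v ->
       decomposable (component (C `\` M) v)) :
    decomposable C.

(** Every vertex [v] requires [u], and what the function of its own component of
    [C] minus [u] requires.  A closed set [M] then contains [u], and meets each
    of these components either in the empty set or in a closed set. *)
Lemma decomposable_delete C u : C u ->
  (forall v, (C `\ u) v -> finite_boundary (component (C `\ u) v) /\
                           decomposable (component (C `\ u) v)) ->
  decomposable C.
Proof.
move=> Cu dec.
have closure D : exists h : T -> seq T, decomposable D ->
    forall M v, M `<=` D -> M !=set0 ->
      (forall x y, M x -> y \in h x -> D y -> M y) -> (D `\` M) v ->
      finite_boundary (component (D `\` M) v) /\
      decomposable (component (D `\` M) v).
  have [[D' h h1 h2]|nd] := pselect (decomposable D); last by exists (fun=> [::]).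
  by exists h => _ M v ? ? ? ?; split; [apply: h1 | apply: h2].
have {closure}[h hP] := choice closure.
(* The component of [v] selects which of the functions applies. *)
pose h' v := u :: h (component (C `\ u) v) v.
suff H M v : M `<=` C -> M !=set0 ->
    (forall x y, M x -> y \in h' x -> C y -> M y) -> (C `\` M) v ->
    finite_boundary (component (C `\` M) v) /\
    decomposable (component (C `\` M) v).
  by apply: (@Decomposable C h') => M v ? ? ? ?; have [] := H M v.
move=> MC [x0 Mx0] Mh [Cv nMv].
have Mu : M u by apply: Mh Mx0 _ Cu; apply: mem_head.
have Cuv : (C `\ u) v by split=> // vu; rewrite vu in nMv.
have [finD decD] := dec v Cuv; have DC := component_sub Cuv.
set D := component (C `\ u) v in finD decD DC.
have MDv : (C `\` M) v by [].
have subD : component (C `\` M) v `<=` D.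
  by apply: component_mono => x [Cx nMx]; split=> // xu; rewrite xu in nMx.
have [[x1 [Mx1 Dx1]]|nMD] := pselect (exists x, M x /\ D x).
  have <- : component (D `\` (M `&` D)) v = component (C `\` M) v.
    apply: component_restrict => x.
      by move=> [Dx nMDx]; have [? _] := DC _ Dx; split=> // Mx; apply: nMDx.
    move=> Dx; split; first exact: subD.
    by have [_ nMx] := component_sub MDv Dx; case.
  apply: (hP D decD (M `&` D)).
  - by move=> ? [].
  - by exists x1.
  - move=> x y [Mx Dx] yh Dy; split=> //; have [Cy _] := DC _ Dy.
    by apply: Mh Mx _ Cy; rewrite inE (component_eq Dx) yh orbT.
  - by split; [apply: component_self | case].
suff -> : component (C `\` M) v = D by [].
have <- : component D v = component (C `\` M) v.
  apply: component_restrict => // x Dx; have [Cx _] := DC _ Dx; split=> // Mx.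
  by apply: nMD; exists x.
by apply: component_restrict.
Qed.

(** If [C] is connected but not decomposable, then deleting any [u] from it leaves
    a component that is not decomposable.  As [C] is connected, this component
    contains a neighbour of [u], which is deleted next.  The deleted vertices form
    a ray. *)
Lemma rayless_decomposable C v : rayless G -> C v -> C `<=` component C v ->
  finite_boundary C -> decomposable C.
Proof.
move=> ray Cv conn fin; apply: contrapT => ndec; apply: ray.
pose bad (c : set T * T) := [/\ c.1 c.2, c.1 `<=` component c.1 c.2,
  finite_boundary c.1 & ~ decomposable c.1].
have step c : exists c', bad c -> [/\ bad c', c'.1 `<=` c.1 `\ c.2 & adj G c.2 c'.2].
  have [[Cc cC finC nd]|] := pselect (bad c); last by exists c.
  move: c Cc cC finC nd => [E u] /= Eu cE finE nd.
  have [w [Ew nw]] : exists w, (E `\ u) w /\ ~ decomposable (component (E `\ u) w).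
    apply: contrapT => all_dec; apply: nd; apply: (decomposable_delete Eu) => w Ew.
    split; last by apply: contrapT => nw; apply: all_dec; exists w.
    exact: finite_boundary_delete finE Ew.
  have DE := component_sub Ew; set D := component (E `\ u) w in nw DE.
  have [p pth lst] := cE w Ew.1.
  have [|[a b] ab [/= nDa Db]] := @arcs_crossing _ (~` D) u p (fun Du => (DE _ Du).2 erefl).
    by rewrite lst => /(_ (component_self _ _)).
  have /adj_inP[/= Gab Ea Eb] := path_arcs pth ab.
  move/contrapT: Db => Db.
  have au : a = u.
    apply: contrapT => au; apply: nDa; apply: joined_trans (Db) _.
    by apply: joined_edge; apply/adj_inP; rewrite adj_sym; split=> //; exact: DE.
  rewrite au in Gab; exists (D, b) => _; split=> //; split=> //=.
    have -> : component D b = D.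
      have eD : component D w = D by apply: component_restrict.
      by rewrite -{2}eD; apply: component_eq; rewrite eD.
    by [].
  exact: finite_boundary_delete finE Ew.
have [next nextP] := choice step.
pose st n := iter n next (C, v).
have bad_st n : bad (st n) by elim: n => [//|n /nextP[]].
have st_sub n d : (st (n + d)).1 `<=` (st n).1.
  elim: d => [|d IH]; first by rewrite addn0.
  rewrite addnS => x; have [_ sub _] := nextP _ (bad_st (n + d)).
  by move=> /sub[/IH].
have st_neq n d : (st (n + d.+1)).2 <> (st n).2.
  have [_ sub _] := nextP _ (bad_st n).
  have [inC _ _ _] := bad_st (n + d.+1).
  by move: inC; rewrite -addSnnS => /st_sub /sub[].
exists (fun n => (st n).2); split=> [n n' e|n]; last first.
  by have [] := nextP _ (bad_st n).
apply/eqP; case: ltngtP => // lt; [have := @st_neq n (n' - n.+1) | have := @st_neq n' (n - n'.+1)].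
  by rewrite -addSnnS subnKC// e.
by rewrite -addSnnS subnKC// e.
Qed.

End Components.

(** * Edge-disjoint rooted forests *)

Lemma induced_adj_vset (T : choiceType) (G : graph T) (Z : set T) x y :
  adj_in G Z x y -> (vset G `&` Z) x.
Proof. by move=> /adj_inP[/adj_vset]. Qed.

Lemma induced_adj_irr (T : choiceType) (G : graph T) (Z : set T) :
  irreflexive (adj_in G Z).
Proof. by move=> x; rewrite /adj_in adj_irr. Qed.

Definition induced {T : choiceType} (G : graph T) (Z : set T) : graph T :=
  Graph (@adj_in_sym _ G Z) (@induced_adj_irr _ G Z)
    (@induced_adj_vset _ G Z).

(** Iterating [par] from the vertex eventually leaves [W].  The inductive form
    needs no count of steps when forests are grafted onto each other. *)
Inductive grounded {T : Type} (W : set T) (par : T -> T) : T -> Prop :=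
| Grounded_out v of ~ W v : grounded W par v
| Grounded_step v of grounded W par (par v) : grounded W par v.

(** A forest in [C] all of whose components hang from one vertex outside [C] or
    from [s].  It is encoded by its vertex set [W] and a parent function; its
    edges join each vertex of [W] to its parent.  In this form a forest can be cut
    down to a smaller set, and forests can be grafted onto each other, without
    any check for cycles. *)
Definition rooted_forest {T : choiceType} (G : graph T) s (C W : set T) par :=
  (forall v, W v -> [/\ C v, v <> s, adj G v (par v) &
     W (par v) \/ ~ C (par v) \/ par v = s]) /\
  (forall v, W v -> grounded W par v).

(** Two parent edges [{v, par v}] and [{w, par' w}] coincide either with [v = w]
    or with their ends exchanged; each case is excluded. *)
Definition parent_disjoint {T : Type} (W W' : set T) (par par' : T -> T) :=
  forall v, W v -> (W' v -> par v <> par' v) /\ (W' (par v) -> par' (par v) <> v).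

Definition forest_system {T : choiceType} (G : graph T) s (C : set T) k
    (W : 'I_k -> set T) (par : 'I_k -> T -> T) :=
  (forall i, rooted_forest G s C (W i) (par i)) /\
  (forall i j, i <> j -> parent_disjoint (W i) (W j) (par i) (par j)).

(** The parent of a vertex is the next vertex on a shortest path to [s]. *)
Lemma connected_parents (T : choiceType) (H : graph T) s :
  connected_graph H -> vset H s ->
  exists (par : T -> T) (dist : T -> nat), forall v, vset H v -> v <> s ->
    adj H v (par v) /\ dist (par v) < dist v.
Proof.
move=> [_ conn] Hs.
pose walk v n := exists p, [/\ path (adj H) v p, last v p = s & size p = n].
have shortest v : exists n, vset H v -> walk v n /\ forall n', walk v n' -> n <= n'.
  have [Hv|] := pselect (vset H v); last by exists 0.
  have [p [_ pth _ lst]] := conn v s Hv Hs.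
  have ex : exists n, `[< walk v n >] by exists (size p); apply/asboolP; exists p.
  exists (ex_minn ex) => _; case: ex_minnP => n /asboolP nw nmin.
  by split=> // n' /asboolP; apply: nmin.
have [dist distP] := choice shortest.
have parent v : exists y, vset H v -> v <> s -> adj H v y /\ dist y < dist v.
  have [[Hv vs]|nvs] := pselect (vset H v /\ v <> s); last first.
    by exists v => Hv vs; case: nvs.
  have [[[|y p] [/= pth lst szp]] _] := distP v Hv; first by case: vs.
  case/andP: pth => vy pth; exists y => _ _; split=> //.
  rewrite -szp ltnS.
  have Hy : vset H y by apply: (@adj_vset _ H y v); rewrite adj_sym.
  by have [_] := distP y Hy; apply; exists p.
have [par parP] := choice parent.
by exists par, dist.
Qed.

Section Kriesell.
Variables (T : choiceType) (G : graph T) (k : nat) (s : T).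
Hypotheses (kriesell : kriesell_conjecture) (k_gt0 : 0 < k) (Gs : vset G s).
Local Notation K := (cut_class G (2 * k) s).

Lemma cut_class_self : K s. Proof. by split=> //; left. Qed.

(** By Menger's theorem, finitely many paths witness that the members of [L] in
    the class of [s] are pairwise [2k]-edge-connected.  Kriesell's conjecture,
    applied to the finite graph spanned by these paths, yields [k] edge-disjoint
    trees containing these members and [s].  Root them at [s] and keep in each
    only the edges that lead from a vertex of [C] to its parent: following parents
    from a vertex of [C] ends at [s] or outside [C], so these are rooted forests,
    and the trees may leave and re-enter [C] at will. *)
Lemma finite_forests (C : set T) (L : seq T) :
  exists (W : 'I_k -> set T) (par : 'I_k -> T -> T) (Q : seq T),
  [/\ forest_system G s C W par, forall i v, W i v -> v \in Q &
      forall i v, v \in L -> K v -> C v -> v <> s -> W i v].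
Proof.
pose R := s :: [seq x <- L | `[< K x >]].
have Rs : s \in R by apply: mem_head.
have RK x : x \in R -> K x.
  rewrite inE mem_filter => /predU1P[->|/andP[/asboolP//]].
  exact: cut_class_self.
have paths (xy : T * T) : exists P : 'I_(2 * k) -> seq T,
    K xy.1 -> K xy.2 -> xy.1 <> xy.2 ->
    (forall i, is_path G xy.1 xy.2 (P i)) /\
    (forall i j, i <> j -> forall a b,
       ~ (path_edge xy.1 (P i) a b /\ path_edge xy.1 (P j) a b)).
  case: xy => x y /=.
  have [[Kx [Ky xy]]|nK] := pselect (K x /\ K y /\ x <> y); last first.
    by exists (fun=> [::]) => Kx Ky xy; case: nK.
  have [P PP] := menger Kx.1 xy (cut_class_connected Kx Ky xy).
  by exists P.
have [P PP] := choice paths.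
(* [s] is added separately, for there may be no pair of distinct terminals. *)
pose Z := [set z | z = s \/ exists x y i,
  [/\ x \in R, y \in R, x <> y & z \in x :: P (x, y) i]].
have PZ x y i : x \in R -> y \in R -> x <> y ->
    is_path (induced G Z) x y (P (x, y) i).
  move=> Rx Ry xy; have [/(_ i)[/= ? pth ? ?] _] := PP (x, y) (RK x Rx) (RK y Ry) xy.
  split=> //; first by split=> //; right; exists x, y, i; rewrite mem_head.
  have inZ z : z \in x :: P (x, y) i -> Z z by move=> ?; right; exists x, y, i.
  apply: (@sub_in_path _ (fun z => `[< Z z >]) (adj G)) pth => [a b Za Zb ab|].
    exact/and3P.
  by apply/allP => z /inZ Zz; apply/asboolP.
have i0 : 'I_(2 * k) by apply: (@Ordinal _ 0); rewrite muln_gt0.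
have joined_s z : vset (induced G Z) z -> joined (adj (induced G Z)) s z.
  move=> [_ [->|[x [y [i [Rx Ry xy zP]]]]]]; first exact: joined_refl.
  have [_ pth _ _] := PZ x y i Rx Ry xy.
  apply: (@joined_trans _ _ x); last exact: path_joined pth zP.
  have [->|/eqP sx] := eqVneq x s; first exact: joined_refl.
  have [_ pth' _ lst] := PZ s x i0 Rs Rx (nesym sx).
  by exists (P (s, x) i0).
have Zfin : finite_set (vset (induced G Z)).
  pose l := s :: flatten [seq xy.1 :: P xy i | xy <- allpairs pair R R, i <- enum 'I_(2 * k)].
  apply: (sub_finite_set _ (finite_seq l)) => z [_ [->|[x [y [i [Rx Ry _ zP]]]]]].
    exact: mem_head.
  rewrite /= inE; apply/orP; right; apply/flattenP; exists (x :: P (x, y) i) => //.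
  apply/allpairsP; exists ((x, y), i); split; rewrite ?mem_enum//.
  by apply/allpairsP; exists (x, y).
have Zconn : connected_graph (induced G Z).
  split; first by exists s; split=> //; left.
  move=> u v Zu Zv; apply: joined_is_path => //.
  apply: (@joined_trans _ _ s); last exact: joined_s.
  by apply: joined_sym; [apply: adj_sym | apply: joined_s].
have RZ : [set x | x \in R] `<=` vset (induced G Z).
  move=> x Rx; split; first by have [] := RK x Rx.
  have [->|/eqP sx] := eqVneq x s; first by left.
  by right; exists x, s, i0; split=> //; exact: mem_head.
have Rconn : edge_connected_in (2 * k) (induced G Z) [set x | x \in R].
  move=> x y Rx Ry xy; exists (P (x, y)); split=> [i|]; first exact: PZ.
  by have [] := PP (x, y) (RK x Rx) (RK y Ry) xy.
have [Ts [Tst Tdis]] := kriesell k_gt0 Zfin Zconn RZ Rconn.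
have TsZ i : subgraph (Ts i) (induced G Z) by have [[]] := Tst i.
have TsR i x : x \in R -> vset (Ts i) x by have [_] := Tst i; apply.
have parents i : exists par : T -> T, exists dist : T -> nat,
    forall v, vset (Ts i) v -> v <> s -> adj (Ts i) v (par v) /\ dist (par v) < dist v.
  apply: connected_parents; last exact: TsR.
  by have [[_ []]] := Tst i.
have [par parP] := choice parents.
have [Q QP] := (finite_seqP _).1 Zfin.
exists (fun i => [set v | [/\ vset (Ts i) v, C v & v <> s]]), par, Q.
have par_in i v : vset (Ts i) v -> v <> s -> vset (Ts i) (par i v).
  move=> Tv vs; have [dist distP] := parP i; have [vp _] := distP v Tv vs.
  by apply: (@adj_vset _ (Ts i) _ v); rewrite adj_sym.
split; first split=> [i|i j ij v [Tv _ vs]].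
- have [dist distP] := parP i; split=> [v [Tv Cv vs]|v].
    have [vp _] := distP v Tv vs; split=> //.
      by have [_ /(_ _ _ vp)/adj_inP[]] := TsZ i.
    have [ps|ps] := pselect (par i v = s); first by right; right.
    have [Cp|nCp] := pselect (C (par i v)); last by right; left.
    by left; split=> //; apply: par_in.
  have [n] := ubnP (dist v); elim: n v => // n IH v dv [Tv Cv vs].
  apply: Grounded_step.
  have [Wp|nWp] := pselect [/\ vset (Ts i) (par i v), C (par i v) & par i v <> s].
    by apply: IH => //; have [_] := distP v Tv vs; lia.
  exact: Grounded_out.
- have [disti Pi] := parP i; have [distj Pj] := parP j.
  have [vp _] := Pi v Tv vs; split=> [[T'v _ _] e|[T'p _ ps] e].
    by have [vp' _] := Pj v T'v vs; apply: (Tdis i j ij v (par i v)); rewrite {2}e.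
  have [vp' _] := Pj _ T'p ps; apply: (Tdis i j ij v (par i v)); split=> //.
  by rewrite adj_sym -{2}e.
- by move=> i v [Tv _ _]; have [/(_ v Tv)] := TsZ i; rewrite QP.
- move=> i v vL Kv Cv vs; split=> //; apply: TsR.
  by rewrite inE mem_filter vL andbT; apply/orP; right; apply/asboolP.
Qed.

(** A sequence of forest systems in [C] that eventually contains every vertex of
    the class in [C], though possibly never all of them at once. *)
Definition limit_forests (C : set T) : Prop :=
  exists (W : nat -> 'I_k -> set T) (par : nat -> 'I_k -> T -> T),
  (forall n, forest_system G s C (W n) (par n)) /\
  (forall x, C x -> K x -> x <> s -> exists N, forall n i, N <= n -> W n i x).

(** Forests on the components of [C] minus [M] are grafted onto a forest system
    living in [M].  Where [good] holds, all the roots of the forest of that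
    component are already present, or are admissible roots for [C].  Disjointness
    survives, because each added edge has its child in one component and so is
    not an edge within [M], nor one added for another component. *)
Lemma glue_forest_systems (C M : set T) (W : 'I_k -> set T) par
    (WD : set T -> 'I_k -> set T) (parD : set T -> 'I_k -> T -> T)
    (good : set T -> 'I_k -> Prop) :
  forest_system G s C W par ->
  (forall i v, W i v -> M v) ->
  (forall v i, (C `\` M) v -> good (component G (C `\` M) v) i ->
     forest_system G s (component G (C `\` M) v)
       (WD (component G (C `\` M) v)) (parD (component G (C `\` M) v)) /\
     (forall x, neighbours G (component G (C `\` M) v) x ->
        W i x \/ ~ C x \/ x = s)) ->
  exists (W' : 'I_k -> set T) par', forest_system G s C W' par' /\
    forall i v, W' i v <-> W i v \/
      [/\ (C `\` M) v, good (component G (C `\` M) v) i &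
          WD (component G (C `\` M) v) i v].
Proof.
move=> [forW disW] WM forD.
pose D v := component G (C `\` M) v.
pose new i v := [/\ (C `\` M) v, good (D v) i & WD (D v) i v].
pose W' i : set T := [set v | W i v \/ new i v].
pose par' i v := if `[< M v >] then par i v else parD (D v) i v.
have parM i v : M v -> par' i v = par i v by move=> Mv; rewrite /par' asboolT.
have parN i v : (C `\` M) v -> par' i v = parD (D v) i v.
  by move=> [_ nMv]; rewrite /par' asboolF.
have newP i v : new i v -> [/\ D v v, v <> s, adj G v (par' i v) &
    new i (par' i v) /\ D (par' i v) = D v \/
    W i (par' i v) \/ ~ C (par' i v) \/ par' i v = s].
  move=> [CMv gv WDv]; have [[/(_ i)[fo _] _] nb] := forD v i CMv gv.
  have [Dv vs vp pP] := fo v WDv; rewrite (parN i v CMv); split=> //.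
  have parent_in : D v (parD (D v) i v) -> D (parD (D v) i v) = D v.
    exact: component_eq.
  case: pP => [Wp|[nDp|ps]]; last by right; right; right.
    have [Dp _ _ _] := fo _ Wp; left; split; last exact: parent_in.
    by split; rewrite ?parent_in//; apply: component_sub Dp.
  by right; apply: nb; split=> //; exists v.
have W'C i v : W' i v -> C v /\ v <> s.
  case=> [Wv|nv]; first by have [/(_ i)[/(_ v Wv)[]]] := (forW, Wv).
  by have [_ vs _ _] := newP i v nv; case: nv => -[].
have W'out i v : ~ C v \/ v = s -> ~ W' i v by case=> [nCv|->] /W'C[].
have nWnew i j v : W i v -> ~ new j v by move=> /WM Mv [[]].
have gW i v : W i v -> grounded (W' i) (par' i) v.
  have [fo gr] := forW i.
  move=> Wv; have grv := gr v Wv; elim: grv Wv => [//|u _ IH Wu].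
  have [_ _ _ pP] := fo u Wu; apply: Grounded_step; rewrite parM; last exact: WM Wu.
  case: pP => [/IH//|out]; apply: Grounded_out; exact: W'out.
exists W', par'; split; last by [].
split=> [i|i j ij v].
- split=> [v|v].
    case=> [Wv|nv].
      have [fo _] := forW i; have [Cv vs vp pP] := fo v Wv.
      rewrite parM; last exact: WM Wv.
      by split=> //; case: pP => [?|?]; [left; left | right].
    have [_ vs vp pP] := newP i v nv; split=> //; first by case: nv => -[].
    by case: pP => [[? _]|[?|?]]; [left; right | left; left | right].
  case=> [/gW//|nv].
  have [CMv gv WDv] := nv; have [[/(_ i)[_ /(_ v WDv) gr] _] _] := forD v i CMv gv.
  move: {2}(D v) (erefl (D v)) gr => E; rewrite -/(D v) => DvE; rewrite DvE => gr.
  elim: gr DvE nv {CMv gv WDv} => [u nWu DuE [_ _]|u _ IH DuE nu].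
    by rewrite DuE.
  apply: Grounded_step; have [CMu _ _] := nu; have [_ _ _] := newP i u nu.
  rewrite (parN i u CMu) DuE => -[[np Dp]|[Wp|out]].
  - exact: IH.
  - exact: gW.
  - apply: Grounded_out; exact: W'out.
- case=> [Wv|nv].
    have [_ _ _ pP] := (forW i).1 v Wv; have [d1 d2] := disW i j ij v Wv.
    have Mv := WM i v Wv; rewrite (parM i v Mv); split.
      by case=> [Wv'|/(nWnew _ _ _ Wv)//]; rewrite parM//; apply: d1.
    case=> [Wp|np]; first by rewrite parM; [apply: d2 | exact: WM Wp].
    case: pP => [/nWnew/(_ np)//|out].
    by have := @W'out j _ out; case; right.
  have [CMv gv WDv] := nv; have [[_ disD] _] := forD v i CMv gv.
  have [d1 d2] := disD i j ij v WDv.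
  have [_ vs _ pP] := newP i v nv; split.
    case=> [/nWnew/(_ nv)//|[_ _ WDjv]].
    by rewrite !parN//; apply: d1.
  case=> [Wp e|np e].
    have [_ _ _] := (forW j).1 _ Wp; rewrite -parM ?e; last exact: WM Wp.
    by case=> [/nWnew/(_ nv)//|out]; have := @W'out i v out; case; right.
  case: pP => [[_ Dp]|[/nWnew/(_ np)//|out]]; last first.
    by have := @W'out j _ out; case; right.
  have [CMp _ WDp] := np; move: e; rewrite (parN j _ CMp) Dp (parN i v CMv).
  apply: d2; move: WDp; rewrite Dp (parN i v CMv); exact.
Qed.
(** Finitely many statements that hold eventually hold eventually together. *)
Lemma common_threshold (X : eqType) (P : nat -> X -> Prop) (l : seq X)
    (Q : X -> Prop) :
  (forall x, Q x -> exists N, forall n, N <= n -> P n x) ->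
  exists N, forall n, N <= n -> forall x, x \in l -> Q x -> P n x.
Proof.
move=> ev; elim: l => [|x l [N HN]]; first by exists 0.
have [Qx|nQx] := pselect (Q x); last first.
  by exists N => n Nn y; rewrite inE => /predU1P[->//|]; apply: HN.
have [N' HN'] := ev x Qx; exists (maxn N N') => n; rewrite geq_max => /andP[Nn Nn'].
by move=> y; rewrite inE => /predU1P[-> _|]; [apply: HN' | apply: HN].
Qed.

(** The central induction.  A countable set [M], the union of finite stages
    [Ls n], is built inside [C].  It is closed under the function of the
    decomposition, under forests covering the part of the class in [Ls n], and
    under finite sets separating from the class those vertices that are outside the
    class and lie in [M] or in the neighbourhood of [C].
    By the last condition, if a component of [C] minus [M] meets the class, then
    all its neighbours belong to the class.  Those outside [M] are admissible roots
    for [C]; those in [M] are finitely many, so all late stages cover them, and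
    from then on the forests that the induction hypothesis gives for the component
    can be grafted on. *)
Lemma decomposable_limit_forests C : decomposable G C -> finite_boundary G C ->
  neighbours G C `<=` K -> limit_forests C.
Proof.
elim=> {}C h finD _ IH [B BP] NK.
have [[c Cc]|C0] := pselect (exists c, C c); last first.
  exists (fun _ _ => set0), (fun _ _ => id); split=> [n|x Cx].
    by split=> [i|i j _ v []]; split=> v [].
  by case: C0; exists x.
have forests (L : seq T) : exists WpQ : ('I_k -> set T) * ('I_k -> T -> T) * seq T,
  [/\ forest_system G s C WpQ.1.1 WpQ.1.2,
      forall i v, WpQ.1.1 i v -> v \in WpQ.2 &
      forall i v, v \in L -> K v -> C v -> v <> s -> WpQ.1.1 i v].
  by have [W [par [Q WpQ]]] := finite_forests C L; exists (W, par, Q).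
have [F FP] := choice forests.
(* A vertex outside the class is separated from it by some finite set. *)
have blocker u : exists X : seq T, vset G u -> ~ K u -> forall p,
    path (adj G) u p -> K (last u p) -> exists2 x, x \in p & x \in X.
  have [[Gu nKu]|] := pselect (vset G u /\ ~ K u); last first.
    by move=> h'; exists [::] => Gu nKu; case: h'.
  apply: contrapT => nX; apply: nKu; apply: cut_class_unblocked => // X.
  apply: contrapT => np; apply: nX; exists X => _ _ p pth Kl.
  apply: contrapT => avoid; apply: np; exists p; split=> // x xp.
  by apply/negP => xX; apply: avoid; exists x.
have [q qP] := choice blocker.
pose g L := [seq x <- L ++ flatten (map h L) ++ (F L).2 ++ flatten (map q (L ++ B))
            | `[< C x >]].
pose Ls n := iter n g [:: c].
have LsC n x : x \in Ls n -> C x.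
  case: n => [|n]; first by rewrite inE => /eqP->.
  by rewrite /= mem_filter => /andP[/asboolP].
have Ls_next n x : C x -> x \in Ls n ++ flatten (map h (Ls n)) ++ (F (Ls n)).2 ++
    flatten (map q (Ls n ++ B)) -> x \in Ls n.+1.
  by move=> Cx xin; rewrite /= mem_filter xin andbT; apply/asboolP.
have Ls_mono n d x : x \in Ls n -> x \in Ls (n + d).
  move=> xn; elim: d => [|d IHd]; first by rewrite addn0.
  rewrite addnS; apply: Ls_next; first exact: LsC xn.
  by rewrite mem_cat IHd.
pose M := [set x | exists n, x \in Ls n].
have MC : M `<=` C by move=> x [n]; apply: LsC.
have M0 : M !=set0 by exists c, 0; apply: mem_head.
have Mh x y : M x -> y \in h x -> C y -> M y.
  move=> [n xn] yh Cy; exists n.+1; apply: Ls_next => //.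
  rewrite !mem_cat; apply/orP; right; apply/orP; left.
  by apply/flattenP; exists (h x) => //; apply: map_f.
have Mq u x : M u \/ neighbours G C u -> x \in q u -> C x -> M x.
  move=> Mu xq Cx.
  have [n un] : exists n, u \in Ls n ++ B.
    case: Mu => [[n un]|/BP uB]; first by exists n; rewrite mem_cat un.
    by exists 0; rewrite mem_cat uB orbT.
  exists n.+1; apply: Ls_next => //; rewrite !mem_cat; do 3 (apply/orP; right).
  by apply/flattenP; exists (q u) => //; apply: map_f.
pose D v := component G (C `\` M) v.
have DC v : (C `\` M) v -> D v `<=` C `\` M by exact: component_sub.
have ND v u : (C `\` M) v -> neighbours G (D v) u -> M u \/ neighbours G C u.
  move=> CMv Nu; have nCMu := neighbours_component CMv Nu.
  have [Cu|nCu] := pselect (C u).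
    by left; apply: contrapT => nMu; apply: nCMu.
  by right; split=> //; case: Nu => _ [w /(DC v CMv)[Cw _] wu]; exists w.
(* A walk from [u] through the component of [v] to the class avoids [M], hence
   avoids the finite set that would separate [u] from the class. *)
have NDK v : (C `\` M) v -> D v `&` K !=set0 -> neighbours G (D v) `<=` K.
  move=> CMv [t [Dt Kt]] u Nu; apply: contrapT => nKu.
  have [nDu [w Dw wu]] := Nu.
  have uw : adj G u w by rewrite adj_sym.
  have [p pth lst] : joined (adj_in G (C `\` M)) w t.
    by apply: joined_trans (Dt); apply: joined_sym Dw; apply: adj_in_sym.
  have [||x xp xq] := qP u (adj_vset uw) nKu (w :: p).
  - rewrite /= uw; apply: sub_path pth => a b; by move=> /adj_inP[].
  - by rewrite /= lst.
  have [Cx nMx] : (C `\` M) x.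
    by apply: (DC v CMv); apply: joined_trans (Dw) _; apply: path_joined pth xp.
  by apply: nMx; apply: Mq xq Cx; apply: ND Nu.
have sub_limit E : exists Wp : (nat -> 'I_k -> set T) * (nat -> 'I_k -> T -> T),
    E `&` K !=set0 -> (exists2 v, (C `\` M) v & E = D v) ->
    (forall n, forest_system G s E (Wp.1 n) (Wp.2 n)) /\
    (forall x, E x -> K x -> x <> s -> exists N, forall n i, N <= n -> Wp.1 n i x).
  have [[EK [v CMv ED]]|nE] := pselect (E `&` K !=set0 /\ exists2 v, (C `\` M) v & E = D v);
    last by exists (fun _ _ => set0, fun _ _ => id) => EK Ev; case: nE.
  rewrite ED in EK *.
  have [W [par Wp]] := IH M v MC M0 Mh CMv (finD M v MC M0 Mh CMv) (NDK v CMv EK).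
  by exists (W, par).
have [WD WDP] := choice sub_limit.
pose WM n := (F (Ls n)).1.1.
have WMM n i v : WM n i v -> M v.
  have [[/(_ i)[fo _] _] Q _] := FP (Ls n) => Wv; have [Cv _ _ _] := fo v Wv.
  by exists n.+1; apply: Ls_next => //; rewrite !mem_cat (Q i v Wv) !orbT.
(* Where a component misses the class, nothing is known about its neighbours, and
   nothing is grafted there. *)
pose good n E i := E `&` K !=set0 /\
  forall x, neighbours G E x -> WM n i x \/ ~ C x \/ x = s.
have glued n : exists Wp : ('I_k -> set T) * ('I_k -> T -> T),
    forest_system G s C Wp.1 Wp.2 /\ forall i v, Wp.1 i v <-> WM n i v \/
      [/\ (C `\` M) v, good n (D v) i & (WD (D v)).1 n i v].
  have [forM _ _] := FP (Ls n).
  have [|v i CMv [EK nb]|W [par Wp]] := @glue_forest_systems C M (WM n) (F (Ls n)).1.2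
      (fun E => (WD E).1 n) (fun E => (WD E).2 n) (good n) forM.
  - exact: WMM.
  - by split=> //; have [] := WDP (D v) EK; first by exists v.
  by exists (W, par).
have [Wp WpP] := choice glued.
exists (fun n => (Wp n).1), (fun n => (Wp n).2); split=> [n|x Cx Kx xs].
  by have [] := WpP n.
have evM y : M y -> K y -> y <> s -> exists N, forall n, N <= n -> forall i, WM n i y.
  move=> [N yN] Ky ys; exists N => n Nn i; have [_ _] := FP (Ls n); apply=> //.
    by rewrite -(subnKC Nn); apply: Ls_mono.
  exact: LsC yN.
have [Mx|nMx] := pselect (M x).
  have [N NP] := evM x Mx Kx xs; exists N => n i Nn.
  by have [_] := WpP n; move=> ->; left; apply: NP.
have CMx : (C `\` M) x by [].
have DK : D x `&` K !=set0 by exists x; split=> //; apply: component_self.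
have [|_ /(_ x (component_self _ _ _) Kx xs)[N1 N1P]] := WDP (D x) DK; first by exists x.
have [BD BDP] := finD M x MC M0 Mh CMx.
have [N2 N2P] := @common_threshold T (fun n y => forall i, WM n i y) BD
  (fun y => [/\ M y, K y & y <> s]) (fun y H => let: And3 a b c' := H in evM y a b c').
exists (maxn N1 N2) => n i; rewrite geq_max => /andP[n1 n2].
have [_ ->] := WpP n; right; split=> //; last exact: N1P.
split=> // y Ny; have [ys|ys] := pselect (y = s); first by right; right.
have [My|[nCy _]] := ND x y CMx Ny; last by right; left.
left; apply: N2P => //; last by split=> //; apply: NDK Ny.
exact: BDP.
Qed.

End Kriesell.

(** * From rooted forests to trees and their limits *)

Section ForestTree.
Variables (T : choiceType) (G : graph T) (s : T) (W : set T) (par : T -> T).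
Hypotheses (Gs : vset G s) (forW : rooted_forest G s setT W par).

Definition parent_adj : rel T :=
  fun x y => `[< W x /\ par x = y >] || `[< W y /\ par y = x >].

Lemma parent_adjP x y :
  reflect (W x /\ par x = y \/ W y /\ par y = x) (parent_adj x y).
Proof. by rewrite /parent_adj -asbool_or; apply: asboolP. Qed.

Lemma rooted_parent v : W v -> adj G v (par v) /\ (W (par v) \/ par v = s).
Proof. by case: forW => fo _ /fo[_ _ ? [|[]//]]; split=> //; [left|right]. Qed.

Lemma parent_adj_sub x y : parent_adj x y -> adj G x y.
Proof.
by move=> /parent_adjP[[/rooted_parent[vp _] <-//]|[/rooted_parent[vp _] <-]]; rewrite adj_sym.
Qed.

Lemma parent_adj_sym : symmetric parent_adj.
Proof. by move=> x y; rewrite /parent_adj orbC. Qed.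

Lemma parent_adj_irr : irreflexive parent_adj.
Proof. by move=> x; apply/negP => /parent_adj_sub; rewrite adj_irr. Qed.

Lemma parent_adj_vset x y : parent_adj x y -> (s |` W) x.
Proof.
by move=> /parent_adjP[[Wx _]|[/rooted_parent[_ pW] <-]]; [right | case: pW; [right|left]].
Qed.

Definition forest_tree : graph T :=
  Graph parent_adj_sym parent_adj_irr parent_adj_vset.

Lemma forest_tree_sub : subgraph forest_tree G.
Proof.
split=> [v [->//|/rooted_parent[vp _]]|]; first exact: adj_vset vp.
exact: parent_adj_sub.
Qed.

Lemma grounded_iter v : grounded W par v -> exists n, ~ W (iter n par v).
Proof.
by elim=> [u nWu|u _ [n nW]]; [exists 0 | exists n.+1; rewrite iterSr].
Qed.

Lemma forest_depth : exists depth : T -> nat, forall v, W v -> depth (par v) < depth v.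
Proof.
have depthP v : exists d, W v ->
    ~ W (iter d par v) /\ forall d', ~ W (iter d' par v) -> d <= d'.
  have [Wv|] := pselect (W v); last by exists 0.
  have [_ /(_ v Wv)/grounded_iter[n nW]] := forW.
  have ex : exists n, ~~ `[< W (iter n par v) >] by exists n; apply/asboolPn.
  exists (ex_minn ex) => _; case: ex_minnP => d /asboolPn ? dmin.
  by split=> // d' ?; apply: dmin; apply/asboolPn.
have [d dP] := choice depthP.
exists (fun v => if `[< W v >] then (d v).+1 else 0) => v Wv.
rewrite (asboolT Wv); case: asboolP => // Wp.
have [nW _] := dP v Wv; have [_ dmin] := dP _ Wp.
case dv: (d v) nW => [|n]; first by [].
by rewrite iterSr => /dmin.
Qed.

(** On a cycle, both neighbours of a vertex of maximal depth would have to be its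
    parent. *)
Lemma forest_tree_tree : tree_graph forest_tree.
Proof.
have [depth depthP] := forest_depth; split.
- have to_s v : (s |` W) v -> joined parent_adj v s.
    case=> [->|Wv]; first exact: joined_refl.
    have [n] := ubnP (depth v); elim: n v Wv => // n IH v Wv dv.
    have [_ pW] := rooted_parent Wv.
    apply: (@joined_trans _ _ (par v)).
      by apply: joined_edge; apply/parent_adjP; left.
    case: pW => [Wp|->]; last exact: joined_refl.
    by apply: IH => //; have := depthP v Wv; lia.
  split; first by exists s; left.
  move=> u v Tu Tv; apply: joined_is_path => //.
  apply: (@joined_trans _ _ s); first exact: to_s.
  by apply: joined_sym; [apply: parent_adj_sym | apply: to_s].
- move=> [c [szc /andP[cyc uc]]].
  have c0 : exists n, has (fun v => depth v == n) c.
    case: (c) szc => // v c' _; exists (depth v); rewrite /= eqxx //.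
  have cmax n : has (fun v => depth v == n) c -> n <= \max_(v <- c) depth v.
    by move=> /hasP[v vc /eqP <-]; apply: leq_bigmax_seq.
  case: (ex_maxnP c0 cmax) => n /hasP[v vc /eqP dv] dmax.
  have up y : y \in c -> parent_adj v y -> y = par v.
    move=> yc /parent_adjP[[_ ->//]|[Wy py]].
    have hasy : has (fun u => depth u == depth y) c by apply/hasP; exists y.
    by have := depthP y Wy; have := dmax _ hasy; rewrite py dv; lia.
  case: (rot_to vc) => i c' rc.
  have memc y : y \in v :: c' -> y \in c by rewrite -rc mem_rot.
  have := cyc; rewrite -(rot_cycle i) rc /=.
  have := uc; rewrite -(rot_uniq i) rc.
  have := szc; rewrite -(size_rot i) rc.
  case: c' memc {rc} => [//|a [//|b c']] memc _ /= uc' /andP[va].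
  rewrite rcons_path => /andP[_ /andP[_ zv]].
  have ea : a = par v by apply: up va; apply: memc; rewrite !inE eqxx orbT.
  have ez : last b c' = par v.
    apply: up; last by rewrite parent_adj_sym.
    by apply: memc; rewrite 2!inE mem_last !orbT.
  by case/and3P: uc' => _; rewrite ea -ez mem_last.
Qed.

End ForestTree.

(** This is where non-principality enters: an ultrafilter containing a singleton
    is principal, so the numbers below [N] can be discarded one by one. *)
Lemma nonprincipal_cofinite (F : set_system nat) : UltraFilter F ->
  (forall n, F <> principal_filter n) -> forall N, F [set n | N <= n].
Proof.
move=> FU np; elim=> [|N IH].
  by apply: filterS filterT => n _.
have [FN|FN] := in_ultra_setVsetC [set N] FU.
  case: (np N); apply/seteqP; split=> A /=.
    move=> FA; apply/principal_filterP; have := filter_ex (filterI FA FN).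
    by move=> [n [An nN]]; move: An; rewrite nN.
  by move=> /principal_filterP AN; apply: filterS FN => n nN; rewrite nN.
apply: filterS (filterI IH FN) => n /= [Nn nN].
by rewrite ltn_neqAle Nn andbT; apply/eqP => Nn'; apply: nN.
Qed.

Theorem theorem4p3 (kriesell : kriesell_conjecture)
    (F : set_system nat) (F_ultra : UltraFilter F)
    (F_nonprincipal : forall n : nat, F <> principal_filter n)
    (k : nat) (k_gt0 : 0 < k)
    (T : choiceType) (G : graph T)
    (G_rayless : rayless G) (G_connected : connected_graph G)
    (S : set T) (S_sub : S `<=` vset G)
    (S_edge_connected : edge_connected_in (2 * k) G S) :
  exists H : 'I_k -> graph T,
    [/\ (forall i, subgraph (H i) G),
        (forall i j, i <> j -> edge_disjoint (H i) (H j)) &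
        forall i, S `<=` vset (H i) /\
          exists Ts : nat -> graph T,
            (forall n, tree_of G (Ts n)) /\ is_flimit F G Ts (H i)].
Proof.
(* If [S] is empty, the root may be any vertex. *)
have [s [Gs SK]] : exists s, vset G s /\ S `<=` cut_class G (2 * k) s.
  have [[s Ss]|nS] := pselect (S !=set0); last first.
    have [[s Gs] _] := G_connected; exists s; split=> // x Sx.
    by case: nS; exists x.
  exists s; split=> [|x Sx]; first exact: S_sub.
  split; first exact: S_sub.
  have [->|/eqP xs] := eqVneq x s; [by left | right].
  have [P [P1 P2]] := S_edge_connected x s Sx Ss xs.
  exact: cut_connected_of_paths P1 P2.
have noN u : ~ neighbours G (vset G) u.
  by move=> [nGu [v Gv vu]]; apply: nGu; apply: (@adj_vset _ G u v); rewrite adj_sym.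
have finG : finite_boundary G (vset G) by exists [::] => u /noN.
have connG : vset G `<=` component G (vset G) s.
  move=> v Gv; have [p [_ pth _ lst]] := G_connected.2 s v Gs Gv.
  exists p => //; apply: sub_path pth => x y xy; apply/adj_inP; split=> //.
    exact: adj_vset xy.
  by apply: (@adj_vset _ G y x); rewrite adj_sym.
have decG := rayless_decomposable G_rayless Gs connG finG.
have [|W [par [forW covW]]] := decomposable_limit_forests kriesell k_gt0 Gs decG finG.
  by move=> u /noN.
have rootW n i : rooted_forest G s setT (W n i) (par n i).
  have [/(_ i)[fo gr] _] := forW n; split=> // v Wv.
  have [Gv vs vp pP] := fo v Wv; split=> //.
  case: pP => [Wp|[nG|ps]]; [by left | | by right; right].
  by case: nG; apply: (@adj_vset _ G _ v); rewrite adj_sym.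
pose Ts i n := forest_tree (rootW n i).
pose lim_adj i : rel T := fun x y => adj G x y && `[< F [set n | adj (Ts i n) x y] >].
have lim_sym i : symmetric (lim_adj i).
  move=> x y; rewrite /lim_adj adj_sym; congr (_ && `[< F _ >]).
  by apply/seteqP; split=> n /=; rewrite parent_adj_sym.
have lim_irr i : irreflexive (lim_adj i) by move=> x; rewrite /lim_adj adj_irr.
have lim_vset i x y : lim_adj i x y -> (vset G `&` [set v | F [set n | vset (Ts i n) v]]) x.
  move=> /andP[xy /asboolP FT]; split=> /=; first exact: adj_vset xy.
  by apply: filterS FT => n /= /(parent_adj_vset (rootW n i)).
exists (fun i => Graph (lim_sym i) (lim_irr i) (lim_vset i)); split.
- by move=> i; split=> [v []//|x y /andP[]].
- move=> i j ij x y [/andP[_ /asboolP Fi] /andP[_ /asboolP Fj]].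
  have [n [/parent_adjP Ei /parent_adjP Ej]] := filter_ex (filterI Fi Fj).
  have [_ /(_ i j ij) dis] := forW n.
  case: Ei => -[Wi <-] in Ej; have [d1 d2] := dis _ Wi.
    by case: Ej => -[Wj e]; [case: (d1 Wj) | case: (d2 Wj)].
  by case: Ej => -[Wj e]; [case: (d2 Wj) | case: (d1 Wj)].
move=> i; split=> [x Sx|].
  split; first exact: S_sub.
  have [->|/eqP xs] := eqVneq x s.
    by apply: filterS filterT => n _; left.
  have [N NP] := covW x (S_sub x Sx) (SK x Sx) xs.
  by apply: filterS (nonprincipal_cofinite F_ultra F_nonprincipal N) => n Nn; right; apply: NP.
exists (Ts i); split=> [n|].
  by split; [apply: forest_tree_sub | apply: forest_tree_tree].
split=> [|v|x y].
- by split=> [v []//|x y /andP[]].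
- by [].
- by split=> [/andP[xy /asboolP FT]|[xy FT]] //; apply/andP; split=> //; apply/asboolP.
Qed.
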